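(* Let $A\in\mathbb{R}^{n\times n}$, let the vector norm be the Euclidean norm, and let $j\in\{1,\dots,q\}$ be such that $\Lambda_j$ is single complex. For all $t\in\mathbb{R}$, $$\|\widehat\Theta_j(t)\|_2=\sqrt{\frac{1-W_j^2}{4}\,f^{\max}_{V_jW_j}(\Omega_j(t))} .$$
   Context: The spectrum of $A$ is partitioned by real parts into $\Lambda_1,\dots,\Lambda_q$, where $\Lambda_j$ contains all eigenvalues with real part $r_j$ and $r_1>\dots>r_q$. $\Lambda_j$ is single complex if it consists of a complex conjugate pair $\lambda_j,\overline{\lambda_j}$ of non-real eigenvalues, each having exactly one Jordan block of maximum order; $\lambda_j$ is the one with positive imaginary part $\omega_j>0$. Let $V$ be an invertible matrix whose columns form a Jordan basis for $A$ and $W=V^{-1}$. Let $v^{(j,1)},\dots,v^{(j,M_j)}$ (columns of $V$) be the unique longest Jordan chain for $\lambda_j$, with $v^{(j,1)}$ an eigenvector; put $v^{(j)}:=v^{(j,1)}$ and let $w^{(j)}$ be the row of $W$ whose index equals the column index of $v^{(j,M_j)}$ in $V$. The basis is chosen so that $\overline{v^{(j,1)}},\dots,\overline{v^{(j,M_j)}}$ are columns of $V$ forming the longest Jordan chain for $\overline{\lambda_j}$ and the row of $W$ corresponding to $\overline{v^{(j,M_j)}}$ is $\overline{w^{(j)}}$. Put $\widehat v^{(j)}:=v^{(j)}/\|v^{(j)}\|_2$, $\widehat w^{(j)}:=w^{(j)}/\|w^{(j)}\|_2$. Polar forms: $\widehat v^{(j)}_k=|\widehat v^{(j)}_k|\mathrm{e}^{\mathrm{i}\alpha_{jk}}$,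 $\widehat w^{(j)}_l=|\widehat w^{(j)}_l|\mathrm{e}^{\mathrm{i}\beta_{jl}}$, $(\widehat v^{(j)})^T\widehat v^{(j)}=V_j\mathrm{e}^{\mathrm{i}\delta_j}$ with $V_j\ge0$; $W_j:=|\widehat w^{(j)}(\widehat w^{(j)})^T|$ (transposes without conjugation; angle of $0$ is any fixed real number). One has $V_j,W_j\in[0,1)$. $\widehat\Theta_j(t):=\big[|\widehat v^{(j)}_k||\widehat w^{(j)}_l|\cos(\omega_jt+\alpha_{jk}+\beta_{jl})\big]_{k,l=1,\dots,n}\in\mathbb{R}^{n\times n}$, and $\|\widehat\Theta_j(t)\|_2$ is its spectral norm. Let $R_j\in\mathbb{R}^{2\times n}$ have rows $\mathrm{Re}(\widehat w^{(j)})$ and $\mathrm{Im}(\widehat w^{(j)})$ and let $\alpha^{(j)}\in\mathbb{R}^2$ be a unit left singular vector of $R_j$ for its largest singular value; $\theta_j$ is the angle between the real axis and $\alpha^{(j)}$ (identifying $\mathbb{R}^2$ with $\mathbb{C}$). Then $\Omega_j(t):=2(\omega_jt+\theta_j)+\delta_j$. $f^{\max}_{V_jW_j}(x):=\max_{\alpha\in\mathbb{R}}\dfrac{1+V_j\cos(x+\alpha)}{1-W_j\cos\alpha}$, $x\in\mathbb{R}$. *)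

(* Defs.v *)
(* MathComp-Analysis; complex numbers are R[i] over an abstract R : realType. *)
From HB Require Import structures.
From mathcomp Require Import all_boot all_order all_algebra.
From mathcomp Require Import boolp classical_sets reals topology normedtype.
From mathcomp Require Import derive trigo.
From mathcomp Require Import complex.

Set Implicit Arguments.
Unset Strict Implicit.
Unset Printing Implicit Defensive.
Import Order.TTheory GRing.Theory Num.Theory.
Import numFieldTopology.Exports numFieldNormedType.Exports.

Local Open Scope classical_set_scope.
Local Open Scope ring_scope.
Local Open Scope complex_scope.

Definition cmod (R : realType) (z : R[i]) : R := ComplexField.Normc.normc z.

Definition cis (R : realType) (x : R) : R[i] := cos x +i* sin x.

(* x is an argument of z; every real x is an argument of 0. *)
Definition is_arg (R : realType) (z : R[i]) (x : R) : Prop :=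
  z = (cmod z)%:C * cis x.

(* Euclidean norms, used for row and column vectors only. *)
Definition rnorm2 (R : realType) (m n : nat) (x : 'M[R]_(m, n)) : R :=
  Num.sqrt (\sum_i \sum_j x i j ^+ 2).

Definition cnorm2 (R : realType) (m n : nat) (x : 'M[R[i]]_(m, n)) : R :=
  Num.sqrt (\sum_i \sum_j cmod (x i j) ^+ 2).

Definition cunit (R : realType) (m n : nat) (x : 'M[R[i]]_(m, n)) :
  'M[R[i]]_(m, n) := ((cnorm2 x)%:C)^-1 *: x.

Definition spectral_norm (R : realType) (m n : nat) (M : 'M[R]_(m, n)) : R :=
  sup [set rnorm2 (M *m x) | x in [set x : 'cV[R]_n | rnorm2 x = 1]].

Definition singular_triple (R : realType) (m n : nat) (M : 'M[R]_(m, n))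
    (s : R) (a : 'cV[R]_m) (b : 'cV[R]_n) : Prop :=
  [/\ 0 <= s, rnorm2 a = 1, rnorm2 b = 1, M *m b = s *: a & M^T *m a = s *: b].

Definition top_left_singular (R : realType) (m n : nat) (M : 'M[R]_(m, n))
    (a : 'cV[R]_m) : Prop :=
  exists s b, singular_triple M s a b /\
    forall s' a' b', singular_triple M s' a' b' -> s' <= s.

Definition complexify (R : realType) (n : nat) (A : 'M[R]_n) : 'M[R[i]]_n :=
  map_mx (real_complex R) A.

(* r enumerates, in strictly decreasing order, the real parts of the
   eigenvalues of A. *)
Definition spectral_abscissae (R : realType) (n : nat) (A : 'M[R]_n) (q : nat)
    (r : 'I_q -> R) : Prop :=
  (forall i j : 'I_q, (i < j)%N -> r j < r i) /\
  (forall x : R, (exists j, r j = x) <->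
    exists2 z : R[i], eigenvalue (complexify A) z & complex.Re z = x).

Definition Lambda (R : realType) (n : nat) (A : 'M[R]_n) (x : R) : set R[i] :=
  [set z | eigenvalue (complexify A) z /\ complex.Re z = x].

(* A Jordan basis, given by the columns of jb_mx.  Chain b belongs to the
   eigenvalue jb_ev b and consists of the jb_top b + 1 columns
   jb_pos b ord0, ..., jb_pos b ord_max, where jb_pos b ord0 is the column of
   an eigenvector; so the Jordan block b has order (jb_top b).+1.  The chains
   need not occupy consecutive columns. *)
Record jordan_basis (R : realType) (n : nat) (A : 'M[R[i]]_n) := JordanBasis {
  jb_num : nat;
  jb_ev : 'I_jb_num -> R[i];
  jb_top : 'I_jb_num -> nat;
  jb_pos : forall b : 'I_jb_num, 'I_(jb_top b).+1 -> 'I_n;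
  jb_mx : 'M[R[i]]_n;
  jb_pos_bij : bijective
    (fun x : {b : 'I_jb_num & 'I_(jb_top b).+1} => jb_pos (tagged x));
  jb_unit : jb_mx \in unitmx;
  jb_head : forall b, A *m col (jb_pos (@ord0 (jb_top b))) jb_mx =
                      jb_ev b *: col (jb_pos (@ord0 (jb_top b))) jb_mx;
  jb_chain : forall b (k l : 'I_(jb_top b).+1), l = k.+1 :> nat ->
    A *m col (jb_pos l) jb_mx =
    jb_ev b *: col (jb_pos l) jb_mx + col (jb_pos k) jb_mx
}.

Arguments jb_pos {R n A} _ _ _.

Definition chain_vec (R : realType) (n : nat) (A : 'M[R[i]]_n)
    (B : jordan_basis A) (b : 'I_(jb_num B)) (k : 'I_(jb_top b).+1) :
  'cV[R[i]]_n := col (jb_pos B b k) (jb_mx B).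

(* The row of the inverse dual to the last vector of the chain b. *)
Definition dual_vec (R : realType) (n : nat) (A : 'M[R[i]]_n)
    (B : jordan_basis A) (b : 'I_(jb_num B)) : 'rV[R[i]]_n :=
  row (jb_pos B b ord_max) (invmx (jb_mx B)).

Definition longest_chain (R : realType) (n : nat) (A : 'M[R[i]]_n)
    (B : jordan_basis A) (z : R[i]) (b : 'I_(jb_num B)) : Prop :=
  jb_ev b = z /\ forall c : 'I_(jb_num B), jb_ev c = z -> (jb_top c <= jb_top b)%N.

(* By uniqueness of the Jordan form, this does not depend on the basis B. *)
Definition one_maximal_block (R : realType) (n : nat) (A : 'M[R[i]]_n)
    (z : R[i]) : Prop :=
  exists B : jordan_basis A, exists! b : 'I_(jb_num B), longest_chain z b.

Definition single_complex (R : realType) (n : nat) (A : 'M[R]_n) (x : R) :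
    Prop :=
  exists z : R[i], [/\ complex.Im z != 0, Lambda A x = [set z; z^*],
    one_maximal_block (complexify A) z & one_maximal_block (complexify A) z^*].

Definition conjugate_chains (R : realType) (n : nat) (A : 'M[R[i]]_n)
    (B : jordan_basis A) (b c : 'I_(jb_num B)) : Prop :=
  [/\ jb_top c = jb_top b,
      forall (k : 'I_(jb_top b).+1) (l : 'I_(jb_top c).+1), k = l :> nat ->
        chain_vec l = map_mx conjc (chain_vec k) &
      dual_vec c = map_mx conjc (dual_vec b)].

Definition ellipse_mx (R : realType) (n : nat) (w : 'rV[R[i]]_n) : 'M[R]_(2, n) :=
  \matrix_(i, l) (if i == 0 then complex.Re (w 0 l) else complex.Im (w 0 l)).

Definition Theta (R : realType) (n : nat) (v : 'cV[R[i]]_n) (w : 'rV[R[i]]_n)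
    (omega : R) (alpha beta : 'I_n -> R) (t : R) : 'M[R]_n :=
  \matrix_(k, l) (cmod (v k 0) * cmod (w 0 l) *
                  cos (omega * t + alpha k + beta l)).

(* The supremum is a maximum for the 0 <= W < 1, see fmax_max. *)
Definition fmax (R : realType) (V W x : R) : R :=
  sup [set (1 + V * cos (x + a)) / (1 - W * cos a) | a in [set: R]].

Lemma fmax_max (R : realType) (V W x : R) : 0 <= W < 1 ->
  exists2 a, fmax V W x = (1 + V * cos (x + a)) / (1 - W * cos a) &
    forall b, (1 + V * cos (x + b)) / (1 - W * cos b) <= fmax V W x.
Proof.
case/andP=> W0 W1; set f := fun a => (1 + V * cos (x + a)) / (1 - W * cos a).
have den a : 1 - W * cos a != 0.
  rewrite subr_eq0 eq_sym lt_eqF //; apply: le_lt_trans W1.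
  by rewrite -[leRHS]mulr1 ler_wpM2l // cos_le1.
have pi0 : 0 <= pi *+ 2 :> R by rewrite mulrn_wge0 // pi_ge0.
have cf : continuous f.
  move=> a; apply: cvgM.
    apply: cvgD; first exact: cvg_cst.
    apply: cvgM; first exact: cvg_cst.
    apply: (continuous_comp (f := +%R x)); last exact: continuous_cos.
    by apply: cvgD; [exact: cvg_cst | exact: cvg_id].
  apply: cvgV => //; apply: cvgB; first exact: cvg_cst.
  by apply: cvgM; [exact: cvg_cst | exact: continuous_cos].
have [c _ hc] := EVT_max pi0 (continuous_subspaceT cf).
have red b : exists2 y, y \in `[0, pi *+ 2] & f y = f b.
  have cb : -1 <= cos b <= 1 by rewrite cos_geN1 cos_le1.
  have s2 : sin (acos (cos b)) = `|sin b|.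
    by rewrite sin_acos // -sin2cos2 sqrtr_sqr.
  have := acos_ge0 cb; have := acos_lepi cb => h1 h0.
  have [sb|sb] := leP 0 (sin b).
    exists (acos (cos b)).
      rewrite in_itv /= h0 (le_trans h1) // mulr2n lerDl; exact: pi_ge0.
    by rewrite /f !cosD acosK // s2 ger0_norm.
  exists (pi *+ 2 - acos (cos b)).
    rewrite in_itv /= gerBl h0 andbT subr_ge0 (le_trans h1) //.
    by rewrite mulr2n lerDl; exact: pi_ge0.
  have ec : cos (pi *+ 2 - acos (cos b)) = cos b.
    by rewrite addrC cosD2pi cosN acosK.
  have es : sin (pi *+ 2 - acos (cos b)) = sin b.
    by rewrite addrC sinD2pi sinN s2 ltr0_norm // opprK.
  by rewrite /f !(cosD x) ec es.
have ub b : f b <= f c by have [y /hc hy <-] := red b.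
suff -> : fmax V W x = f c by exists c.
apply/eqP; rewrite eq_le; apply/andP; split.
  by apply: ge_sup; [exists (f c), c | move=> _ [b _ <-]; exact: ub].
by apply: ub_le_sup; [exists (f c) => _ [b _ <-]; exact: ub | exists c].
Qed.

(* Main.v *)
Require Import Defs.
From HB Require Import structures.
From mathcomp Require Import all_boot all_order all_algebra.
From mathcomp Require Import boolp classical_sets reals topology normedtype.
From mathcomp Require Import derive trigo.
From mathcomp Require Import complex.
From mathcomp Require Import ring lra.

Set Implicit Arguments.
Unset Strict Implicit.
Unset Printing Implicit Defensive.
Import Order.TTheory GRing.Theory Num.Theory.
Local Open Scope classical_set_scope.
Local Open Scope ring_scope.
Local Open Scope complex_scope.

(* Rotating what by -theta aligns its real and imaginary parts with the singular
   vectors: exp(-i theta) what = g + i h with g, h orthogonal, and |g|^2 + |h|^2 = 1,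
   |g|^2 - |h|^2 = W, so |g|^2 = (1 + W)/2 and |h|^2 = (1 - W)/2.  Moreover h != 0,
   i.e. W < 1, since otherwise the rows of the inverse Jordan basis dual to the two
   conjugate chains would be proportional.  Writing exp(i (omega t + theta)) vhat =
   p + i q, Theta is the rank two matrix p g^T - q h^T, hence
   |Theta x|^2 = r^2 (1 + V cos (Omega + a)) / 2 where
   <g, x> + i <h, x> = r exp(i a / 2).  The points (<g, x>, <h, x>) with |x| = 1 lie
   in the ellipse r^2 (1 - W cos a) <= (1 - W^2)/2 and cover its boundary. *)

(** * Inner products of real vectors, written as functions so that rows, columns and their
    combinations are treated alike *)

Definition dot (R : realType) (n : nat) (f g : 'I_n -> R) : R :=
  \sum_i f i * g i.

Lemma dot_comb (R : realType) (n : nat) (a b c d : R) (f g h k : 'I_n -> R) :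
  dot (fun i => a * f i + b * g i) (fun i => c * h i + d * k i) =
  a * c * dot f h + a * d * dot f k + b * c * dot g h + b * d * dot g k.
Proof.
rewrite /dot !mulr_sumr -!big_split /=; apply: eq_bigr => i _; ring.
Qed.

Lemma dotC (R : realType) (n : nat) (f g : 'I_n -> R) : dot f g = dot g f.
Proof. by apply: eq_bigr => i _; rewrite mulrC. Qed.

Lemma dot_ge0 (R : realType) (n : nat) (f : 'I_n -> R) : 0 <= dot f f.
Proof. by apply: sumr_ge0 => i _; rewrite -expr2 sqr_ge0. Qed.

Lemma dot_eq0 (R : realType) (n : nat) (f : 'I_n -> R) :
  dot f f = 0 -> forall i, f i = 0.
Proof.
move=> /eqP; rewrite psumr_eq0 => [/allP h i|i _]; last by rewrite -expr2 sqr_ge0.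
by have := h i (mem_index_enum i); rewrite mulf_eq0 orbb => /eqP.
Qed.

(** The difference of the two sides is the squared norm of [x] minus its orthogonal projection onto
    the span of [f] and [g]; in the proof, [y] is the negative of this projection. *)
Lemma bessel2 (R : realType) (n : nat) (f g x : 'I_n -> R) :
  0 < dot f f -> 0 < dot g g -> dot f g = 0 ->
  dot f x ^+ 2 / dot f f + dot g x ^+ 2 / dot g g <= dot x x.
Proof.
move=> f0 g0 fg; rewrite -subr_ge0.
pose y := fun i => - (dot f x / dot f f) * f i + - (dot g x / dot g g) * g i.
have := dot_ge0 (fun i => 1 * x i + 1 * y i).
rewrite dot_comb (dotC x y).
have -> : dot y x = - (dot f x ^+ 2 / dot f f + dot g x ^+ 2 / dot g g).
  have -> : dot y x = dot y (fun i => 1 * x i + 0 * x i).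
    by apply: eq_bigr => i _; rewrite mul1r mul0r addr0.
  rewrite dot_comb; ring.
rewrite dot_comb (dotC g f) fg.
suff -> : - (dot f x / dot f f) * - (dot f x / dot f f) * dot f f +
   - (dot f x / dot f f) * - (dot g x / dot g g) * 0 +
   - (dot g x / dot g g) * - (dot f x / dot f f) * 0 +
   - (dot g x / dot g g) * - (dot g x / dot g g) * dot g g =
   dot f x ^+ 2 / dot f f + dot g x ^+ 2 / dot g g.
  by move=> h; lra.
by field; rewrite !gt_eqF.
Qed.

(** * Polar angles and the quadratic form behind [fmax] *)

Lemma cos_sin_surj (R : realType) (x y : R) : x ^+ 2 + y ^+ 2 = 1 ->
  exists a, x = cos a /\ y = sin a.
Proof.
move=> h.
have x1 : -1 <= x <= 1.
  rewrite -ler_norml -(@ler_pXn2r _ 2) ?nnegrE // expr1n real_normK ?num_real //.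
  by rewrite -h lerDl sqr_ge0.
have s : sin (acos x) = `|y|.
  by rewrite sin_acos // -sqrtr_sqr -h; congr Num.sqrt; ring.
have [y0|y0] := leP 0 y.
  by exists (acos x); rewrite acosK // s ger0_norm.
by exists (- acos x); rewrite cosN sinN acosK // s ltr0_norm // opprK.
Qed.

(** The angle [a] is twice the argument of y + iz: the equations are the real and imaginary parts of
    (y + iz)^2 = |y + iz|^2 e^(ia). If y = z = 0, any angle serves. *)
Lemma polar_half (R : realType) (y z : R) : exists a,
  y ^+ 2 - z ^+ 2 = (y ^+ 2 + z ^+ 2) * cos a /\
  2 * y * z = (y ^+ 2 + z ^+ 2) * sin a.
Proof.
have [s0|s0] := eqVneq (y ^+ 2 + z ^+ 2) 0.
  move: (s0) => /eqP; rewrite paddr_eq0 ?sqr_ge0 // !sqrf_eq0 => /andP[/eqP-> /eqP->].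
  by exists 0; split; ring.
have [|a [h1 h2]] := @cos_sin_surj _ ((y ^+ 2 - z ^+ 2) / (y ^+ 2 + z ^+ 2))
   (2 * y * z / (y ^+ 2 + z ^+ 2)).
  by field.
by exists a; rewrite -h1 -h2; split; field.
Qed.

(** With y + iz = r e^(ia/2), the left side is r^2 (1 + V cos (x + a)) and the factor of [fmax] is
    r^2 (1 - W cos a), so this is the homogeneous form of the bound that defines [fmax]. *)
Lemma fmax_quadratic (R : realType) (V W x y z : R) : 0 <= W < 1 ->
  y ^+ 2 + z ^+ 2 + V * (cos x * (y ^+ 2 - z ^+ 2) - sin x * (2 * y * z)) <=
  fmax V W x * ((1 - W) * y ^+ 2 + (1 + W) * z ^+ 2).
Proof.
move=> /[dup] W01 /andP[W0 W1].
have [_ _ ub] := fmax_max V x W01.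
have [a [h1 h2]] := polar_half y z.
have -> : (1 - W) * y ^+ 2 + (1 + W) * z ^+ 2 =
  (y ^+ 2 + z ^+ 2) * (1 - W * cos a).
  by rewrite mulrBr [_ * (W * _)]mulrCA -h1; ring.
rewrite h1 h2.
have -> : y ^+ 2 + z ^+ 2 + V * (cos x * ((y ^+ 2 + z ^+ 2) * cos a) -
    sin x * ((y ^+ 2 + z ^+ 2) * sin a)) =
    (y ^+ 2 + z ^+ 2) * (1 + V * cos (x + a)) by rewrite cosD; ring.
rewrite mulrCA ler_wpM2l ?addr_ge0 ?sqr_ge0 //.
rewrite -ler_pdivrMr // subr_gt0; apply: le_lt_trans W1.
by rewrite -[leRHS]mulr1 ler_wpM2l // cos_le1.
Qed.

(** * Spectral norms, in particular of p g^T - q h^T *)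

Lemma rnorm2_col (R : realType) (n : nat) (x : 'cV[R]_n) :
  rnorm2 x = Num.sqrt (dot (x^~ 0) (x^~ 0)).
Proof. by congr Num.sqrt; apply: eq_bigr => i _; rewrite big_ord1 expr2. Qed.

Lemma rnorm2_col_eq1 (R : realType) (n : nat) (x : 'cV[R]_n) :
  rnorm2 x = 1 <-> dot (x^~ 0) (x^~ 0) = 1.
Proof.
rewrite rnorm2_col; split=> [h|->]; last by rewrite sqrtr1.
by rewrite -[LHS]sqr_sqrtr ?dot_ge0 // h expr1n.
Qed.

Lemma spectral_norm_max (R : realType) (m n : nat) (M : 'M[R]_(m, n)) (K : R) :
  (forall x : 'cV[R]_n, rnorm2 x = 1 -> rnorm2 (M *m x) <= K) ->
  (exists2 x : 'cV[R]_n, rnorm2 x = 1 & rnorm2 (M *m x) = K) ->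
  spectral_norm M = K.
Proof.
move=> ub [x x1 xK]; apply/eqP; rewrite eq_le; apply/andP; split.
  by apply: ge_sup; [exists K, x | move=> _ [y y1 <-]; exact: ub].
by apply: ub_le_sup; [exists K => _ [y y1 <-]; exact: ub | exists x].
Qed.

(** The conditions on [p] and [q] say that p + iq has norm 1 and that its entries have squares
    summing to V e^(ix). The upper bound combines [bessel2] with [fmax_quadratic]; a maximiser of
    [fmax] yields a unit vector attaining it. *)
Lemma spectral_norm_rank2 (R : realType) (m n : nat) (p q : 'I_m -> R)
    (g h : 'I_n -> R) (V W x : R) (M : 'M[R]_(m, n)) :
  0 <= W < 1 ->
  (forall k l, M k l = p k * g l - q k * h l) ->
  dot p p + dot q q = 1 -> dot p p - dot q q = V * cos x ->
  2 * dot p q = V * sin x ->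
  dot g g = (1 + W) / 2 -> dot h h = (1 - W) / 2 -> dot g h = 0 ->
  spectral_norm M = Num.sqrt ((1 - W ^+ 2) / 4 * fmax V W x).
Proof.
move=> /[dup] W01 /andP[W0 W1] ME pq1 pq2 pq3 gg hh gh.
have W1' : 0 < 1 - W by rewrite subr_gt0.
have W1'' : 0 < 1 + W by lra.
have W2 : 0 < 1 - W ^+ 2 by rewrite subr_gt0 expr_lt1.
have g0 : 0 < dot g g by rewrite gg divr_gt0.
have h0 : 0 < dot h h by rewrite hh divr_gt0.
have normM (y : 'cV[R]_n) : rnorm2 (M *m y) = Num.sqrt
    ((dot g (y^~ 0) ^+ 2 + dot h (y^~ 0) ^+ 2 +
     V * (cos x * (dot g (y^~ 0) ^+ 2 - dot h (y^~ 0) ^+ 2) -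
          sin x * (2 * dot g (y^~ 0) * dot h (y^~ 0)))) / 2).
  set u := dot g _; set v := dot h _.
  rewrite rnorm2_col; congr Num.sqrt.
  have -> : dot ((M *m y)^~ 0) ((M *m y)^~ 0) =
      dot (fun k => u * p k + - v * q k) (fun k => u * p k + - v * q k).
    suff E k : (M *m y) k 0 = u * p k + - v * q k.
      by apply: eq_bigr => k _; rewrite !E.
    rewrite mxE /u /v /dot mulNr !mulr_suml -sumrB.
    by apply: eq_bigr => l _; rewrite ME; ring.
  rewrite dot_comb (dotC q p).
  have -> : dot p p = (1 + V * cos x) / 2 by lra.
  have -> : dot q q = (1 - V * cos x) / 2 by lra.
  have -> : dot p q = V * sin x / 2 by lra.
  by field.
have [a fa fub] := fmax_max V x W01.
have ca b : 0 < 1 - W * cos b.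
  rewrite subr_gt0; apply: le_lt_trans W1.
  by rewrite -[leRHS]mulr1 ler_wpM2l // cos_le1.
apply: spectral_norm_max => [y /rnorm2_col_eq1 y1|].
  (* At the angle pi/2 - x the cosine in the numerator vanishes, which leaves a positive
     quotient. *)
  have fm0 : 0 <= fmax V W x.
    have := fub (pi / 2 - x); rewrite [x + _]addrC subrK cos_pihalf mulr0 addr0.
    by apply: le_trans; rewrite divr_ge0 // ltW.
  rewrite normM ler_wsqrtr //.
  have := bessel2 (y^~ 0) g0 h0 gh; rewrite y1 gg hh.
  set u := dot g _; set v := dot h _ => bes.
  (* Bessel's inequality times (1 - W^2)/2: the point (u, v) lies in the ellipse. *)
  have bes' : (1 - W) * u ^+ 2 + (1 + W) * v ^+ 2 <= (1 - W ^+ 2) / 2.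
    have -> : (1 - W) * u ^+ 2 + (1 + W) * v ^+ 2 =
      (1 - W ^+ 2) / 2 * (u ^+ 2 / ((1 + W) / 2) + v ^+ 2 / ((1 - W) / 2)).
      by field; rewrite !gt_eqF.
    by rewrite -[leRHS]mulr1 ler_wpM2l // divr_ge0 // ltW.
  have := fmax_quadratic V x u v W01 => /le_trans H.
  have := H _ (ler_wpM2l fm0 bes'); lra.
(* This radius puts the point (u, v) with polar angle a/2 on the boundary of the ellipse, where [a]
   maximises the quotient in [fmax]. *)
pose r := Num.sqrt ((1 - W ^+ 2) / 2 / (1 - W * cos a)).
have r2 : r ^+ 2 = (1 - W ^+ 2) / 2 / (1 - W * cos a).
  by rewrite sqr_sqrtr // !divr_ge0 // ltW.
pose u := r * cos (a / 2); pose v := r * sin (a / 2).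
have aE : a = a / 2 + a / 2 by field.
have cE : cos a = cos (a / 2) ^+ 2 - sin (a / 2) ^+ 2.
  by rewrite {1}aE cosD !expr2.
have sE : sin a = 2 * cos (a / 2) * sin (a / 2) by rewrite {1}aE sinD; ring.
have c1 : cos (a / 2) ^+ 2 + sin (a / 2) ^+ 2 = 1 by rewrite cos2Dsin2.
(* The vector in the span of the orthogonal pair [g], [h] whose inner products with them are [u] and
   [v]; lying in the span, it gives equality in Bessel's inequality. *)
pose y : 'cV[R]_n := \col_l (u / dot g g * g l + v / dot h h * h l).
have yE f : dot f (y^~ 0) = u / dot g g * dot f g + v / dot h h * dot f h.
  rewrite /dot !mulr_sumr -big_split; apply: eq_bigr => l _.
  by rewrite mxE /=; ring.
have gy : dot g (y^~ 0) = u by rewrite yE gh mulr0 addr0 divfK ?gt_eqF.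
have hy : dot h (y^~ 0) = v.
  by rewrite yE (dotC h g) gh mulr0 add0r divfK ?gt_eqF.
have cos2 : cos (a / 2) ^+ 2 = (1 + cos a) / 2 by lra.
have sin2 : sin (a / 2) ^+ 2 = (1 - cos a) / 2 by lra.
exists y.
  apply/rnorm2_col_eq1; rewrite yE (dotC _ g) (dotC _ h) gy hy gg hh.
  rewrite /u /v.
  transitivity (r ^+ 2 * (cos (a / 2) ^+ 2 / ((1 + W) / 2)
     + sin (a / 2) ^+ 2 / ((1 - W) / 2))).
    by field; rewrite !gt_eqF.
  by rewrite r2 cos2 sin2; field; rewrite !gt_eqF.
rewrite normM gy hy fa; congr Num.sqrt.
transitivity (r ^+ 2 * (1 + V * cos (x + a)) / 2).
  rewrite cosD sE /u /v !exprMn cos2 sin2; by field.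
by rewrite r2; field; rewrite !gt_eqF.
Qed.

(** * Real and imaginary parts, moduli and normalisation of complex vectors *)

Lemma Re_sum (R : realType) (n : nat) (f : 'I_n -> R[i]) :
  complex.Re (\sum_i f i) = \sum_i complex.Re (f i).
Proof. by apply: (big_morph (@complex.Re R)) => // -[? ?] [? ?]. Qed.

Lemma Im_sum (R : realType) (n : nat) (f : 'I_n -> R[i]) :
  complex.Im (\sum_i f i) = \sum_i complex.Im (f i).
Proof. by apply: (big_morph (@complex.Im R)) => // -[? ?] [? ?]. Qed.

Lemma Re_sum_sqr (R : realType) (n : nat) (f : 'I_n -> R[i]) :
  complex.Re (\sum_i f i * f i) =
  dot (fun i => complex.Re (f i)) (fun i => complex.Re (f i)) -
  dot (fun i => complex.Im (f i)) (fun i => complex.Im (f i)).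
Proof.
by rewrite Re_sum /dot -sumrB; apply: eq_bigr => i _ /=; case: (f i).
Qed.

Lemma Im_sum_sqr (R : realType) (n : nat) (f : 'I_n -> R[i]) :
  complex.Im (\sum_i f i * f i) = 2 * dot (fun i => complex.Re (f i)) (fun i => complex.Im (f i)).
Proof.
rewrite Im_sum /dot mulr_sumr; apply: eq_bigr => i _ /=.
by case: (f i) => x y /=; ring.
Qed.

Lemma cmod_ge0 (R : realType) (z : R[i]) : 0 <= cmod z.
Proof. by case: z => x y; exact: sqrtr_ge0. Qed.

Lemma sqr_cmod (R : realType) (z : R[i]) :
  cmod z ^+ 2 = complex.Re z ^+ 2 + complex.Im z ^+ 2.
Proof. by case: z => x y; rewrite sqr_sqrtr // addr_ge0 ?sqr_ge0. Qed.

Lemma is_argE (R : realType) (z : R[i]) (x : R) : is_arg z x ->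
  complex.Re z = cmod z * cos x /\ complex.Im z = cmod z * sin x.
Proof. by move=> zx; split; rewrite {1}zx /=; ring. Qed.

Lemma cnorm2_neq0 (R : realType) (m n : nat) (x : 'M[R[i]]_(m, n)) :
  x != 0 -> cnorm2 x != 0.
Proof.
apply: contraNneq => /eqP; rewrite sqrtr_eq0 => le0; apply/eqP/matrixP => i k.
have s0 : \sum_i \sum_j cmod (x i j) ^+ 2 = 0.
  apply/le_anti; rewrite le0 sumr_ge0 // => ? _; rewrite sumr_ge0 // => ? _.
  exact: sqr_ge0.
have /allP/(_ i (mem_index_enum i)) :
    all (fun i => true ==> (\sum_j cmod (x i j) ^+ 2 == 0)) (index_enum 'I_m).
  by rewrite -psumr_eq0 ?s0 // => ? _; rewrite sumr_ge0 // => ? _; exact: sqr_ge0.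
rewrite /= psumr_eq0 => [/allP/(_ k (mem_index_enum k))|? _]; last exact: sqr_ge0.
by rewrite /= sqrf_eq0 mxE => /eqP/ComplexField.Normc.eq0_normc.
Qed.

Lemma cunitE (R : realType) (m n : nat) (x : 'M[R[i]]_(m, n)) i k :
  cunit x i k = (cnorm2 x)^-1%:C * x i k.
Proof. by rewrite mxE fmorphV. Qed.

Lemma cunit_norm (R : realType) (m n : nat) (x : 'M[R[i]]_(m, n)) : x != 0 ->
  \sum_i \sum_j (complex.Re (cunit x i j) ^+ 2 + complex.Im (cunit x i j) ^+ 2)
  = 1.
Proof.
move=> /cnorm2_neq0 x0.
transitivity ((cnorm2 x)^-2 * \sum_i \sum_j cmod (x i j) ^+ 2).
  rewrite mulr_sumr; apply: eq_bigr => i _.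
  rewrite mulr_sumr; apply: eq_bigr => k _.
  by rewrite sqr_cmod cunitE; case: (x i k) => ? ? /=; field.
rewrite -(sqr_sqrtr (a := \sum_i _)) ?mulVf ?sqrf_eq0 //.
by rewrite sumr_ge0 // => ? _; rewrite sumr_ge0 // => ? _; exact: sqr_ge0.
Qed.

(** * Rows of invertible matrices and of their inverses *)

Lemma row_invmx_inj (F : fieldType) (n : nat) (U : 'M[F]_n) (p q : 'I_n) (k : F) :
  U \in unitmx -> row p (invmx U) = k *: row q (invmx U) -> p = q.
Proof.
move=> Uu /(congr1 (mulmx^~ U)).
(* Multiplication by [U] turns the rows of the inverse into standard basis rows; at entry [p] these
   read 1 on the left and, if [p] and [q] differ, 0 on the right. *)
rewrite -scalemxAl -!row_mul mulVmx // => /matrixP/(_ 0 p).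
rewrite !mxE eqxx => /eqP; case: (eqVneq q p) => // _.
by rewrite mulr0 oner_eq0.
Qed.

Lemma unitmx_row_neq0 (F : fieldType) (n : nat) (U : 'M[F]_n) (p : 'I_n) :
  U \in unitmx -> row p U != 0.
Proof.
move=> Uu; apply/eqP => /(congr1 (mulmx^~ (invmx U))).
rewrite -row_mul mulmxV // mul0mx => /matrixP/(_ 0 p).
by rewrite !mxE eqxx => /eqP; rewrite oner_eq0.
Qed.

(** * Singular vectors of a matrix with two rows *)

Lemma sum_ord2 (V : nmodType) (f : 'I_2 -> V) : \sum_i f i = f 0 + f 1.
Proof.
rewrite big_ord_recl big_ord1; congr (f _ + f _); exact: val_inj.
Qed.

(** Here g = M^T a and h = M^T a', where a' is [a] turned by a right angle. Since [a] is an
    eigenvector of M M^T, [g] and [h] are orthogonal. A nonzero [h] makes |h| a singular value with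
    left vector a', hence at most the largest one, which is |g|. *)
Lemma top_left_singular_rotation (R : realType) (n : nat) (M : 'M[R]_(2, n))
    (a : 'cV[R]_2) (theta : R) :
  top_left_singular M a -> a 0 0 = cos theta -> a 1 0 = sin theta ->
  let g := fun l => cos theta * M 0 l + sin theta * M 1 l in
  let h := fun l => - sin theta * M 0 l + cos theta * M 1 l in
  dot g h = 0 /\ dot h h <= dot g g.
Proof.
move=> [s [b [[s0 _ _ Mb Ma] smax]]] a0 a1 g h.
have c1 := cos2Dsin2 theta.
have gE l : g l = s * b l 0.
  have /matrixP/(_ l 0) := Ma.
  by rewrite !mxE sum_ord2 !mxE a0 a1 => <-; rewrite /g; ring.
have MgE i : dot (M i) g = s ^+ 2 * a i 0.
  have /matrixP/(_ i 0) := Mb; rewrite !mxE => Mbi.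
  rewrite expr2 -mulrA -Mbi mulr_sumr; apply: eq_bigr => l _.
  by rewrite gE; ring.
have gM f : dot g f = cos theta * dot (M 0) f + sin theta * dot (M 1) f.
  by rewrite /dot !mulr_sumr -big_split; apply: eq_bigr => l _; rewrite /g /=; ring.
have hM f : dot h f = - sin theta * dot (M 0) f + cos theta * dot (M 1) f.
  by rewrite /dot !mulr_sumr -big_split; apply: eq_bigr => l _; rewrite /h /=; ring.
have gh : dot g h = 0 by rewrite dotC hM !MgE a0 a1; ring.
have gg : dot g g = s ^+ 2.
  by rewrite gM !MgE a0 a1 -[RHS]mulr1 -c1; ring.
split=> //; rewrite gg.
(* A zero [h] cannot be normalised to a right singular vector, but then the bound is trivial. *)
have [->|h0] := eqVneq (dot h h) 0; first exact: sqr_ge0.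
pose t := Num.sqrt (dot h h).
have t2 : t ^+ 2 = dot h h by rewrite sqr_sqrtr ?dot_ge0.
have t0 : 0 < t by rewrite sqrtr_gt0 lt_def h0 dot_ge0.
rewrite -t2 ler_pXn2r ?nnegrE // ?(ltW t0) //.
apply: (smax t (\col_i (if i == 0 then - sin theta else cos theta))
  (\col_l (t^-1 * h l))).
have M0 l : M 0 l = cos theta * g l + - sin theta * h l.
  by rewrite -[LHS]mul1r -c1 /g /h; ring.
have M1 l : M 1 l = sin theta * g l + cos theta * h l.
  by rewrite -[LHS]mul1r -c1 /g /h; ring.
split; first exact: ltW.
- apply/rnorm2_col_eq1; rewrite /dot sum_ord2 !mxE /=.
  by rewrite -c1; ring.
- apply/rnorm2_col_eq1; transitivity (t^-1 ^+ 2 * dot h h).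
    by rewrite /dot mulr_sumr; apply: eq_bigr => l _; rewrite !mxE; ring.
  by rewrite -t2 exprVn mulVf // sqrf_eq0 gt_eqF.
- apply/matrixP => i k; rewrite !mxE.
  transitivity (t^-1 * dot (M i) h).
    by rewrite /dot mulr_sumr; apply: eq_bigr => l _; rewrite !mxE; ring.
  have -> : dot (M i) h = t ^+ 2 * (if i == 0 then - sin theta else cos theta).
    have E u v : (forall l, M i l = u * g l + v * h l) -> dot (M i) h = v * t ^+ 2.
      move=> Mi; rewrite t2 -[RHS]add0r -(mulr0 u) -gh /dot !mulr_sumr -big_split.
      by apply: eq_bigr => l _; rewrite Mi /=; ring.
    rewrite mulrC; case: eqP => [i0|/eqP i0]; apply: E => l.
      by rewrite i0; exact: M0.
    have -> : i = 1 by case: i i0 => [[|[|]]] // ? ?; exact: val_inj.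
    exact: M1.
  by field; rewrite gt_eqF.
- apply/matrixP => l k; rewrite !mxE sum_ord2 !mxE /=.
  rewrite /h; field; rewrite gt_eqF //.
Qed.

(** * From the Jordan basis to the rank two form of [Theta] *)

Theorem proposition15 (R : realType) (n : nat) (A : 'M[R]_n)
  (* Lambda_1, ..., Lambda_q, and j with Lambda_j single complex *)
  (q : nat) (r : 'I_q -> R) (hr : spectral_abscissae A r)
  (j : 'I_q) (hj : single_complex A (r j))
  (lambda : R[i]) (hlambda : Lambda A (r j) lambda)
  (hIm : 0 < complex.Im lambda)
  (* Jordan basis, with longest chains b for lambda and c for its conjugate *)
  (B : jordan_basis (complexify A)) (b c : 'I_(jb_num B))
  (hb : longest_chain lambda b) (hc : longest_chain lambda^* c)
  (hbc : conjugate_chains b c) :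
  let vhat : 'cV[R[i]]_n := cunit (chain_vec (@ord0 (jb_top b))) in
  let what : 'rV[R[i]]_n := cunit (dual_vec b) in
  let omega : R := complex.Im lambda in
  let vv : R[i] := (vhat^T *m vhat) 0 0 in
  let Vj : R := cmod vv in
  let Wj : R := cmod ((what *m what^T) 0 0) in
  forall (alpha beta : 'I_n -> R) (delta theta : R) (a : 'cV[R]_2),
    (forall k, is_arg (vhat k 0) (alpha k)) ->
    (forall l, is_arg (what 0 l) (beta l)) ->
    is_arg vv delta ->
    top_left_singular (ellipse_mx what) a ->
    a 0 0 = cos theta -> a 1 0 = sin theta ->
  forall t : R,
    let Omega : R := 2 * (omega * t + theta) + delta in
    spectral_norm (Theta vhat what omega alpha beta t) =
      Num.sqrt ((1 - Wj ^+ 2) / 4 * fmax Vj Wj Omega).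
Proof.
move=> vhat what omega vv Vj Wj alpha beta delta theta a hal hbe hde hsing a0 a1 t.
move=> Omega.
have [_ _ dual_conj] := hbc.
have v0 : chain_vec (@ord0 (jb_top b)) != 0.
  have := unitmx_row_neq0 (U := (jb_mx B)^T) (jb_pos B b ord0).
  rewrite unitmx_tr -tr_col => /(_ (jb_unit B)); apply: contraNneq.
  by rewrite /chain_vec => ->; rewrite trmx0.
have w0 : dual_vec b != 0 by rewrite unitmx_row_neq0 // unitmx_inv jb_unit.
have := cunit_norm v0; have := cunit_norm w0; rewrite -/vhat -/what => wn vn.
pose vr k := complex.Re (vhat k 0); pose vi k := complex.Im (vhat k 0).
pose wr l := complex.Re (what 0 l); pose wi l := complex.Im (what 0 l).
have {}vn : dot vr vr + dot vi vi = 1.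
  rewrite -vn /dot -big_split; apply: eq_bigr => k _.
  by rewrite big_ord1 !expr2.
have {}wn : dot wr wr + dot wi wi = 1.
  by rewrite -wn big_ord1 /dot -big_split; apply: eq_bigr => k _; rewrite !expr2.
have vvE : vv = \sum_k vhat k 0 * vhat k 0.
  by rewrite /vv mxE; apply: eq_bigr => k _; rewrite mxE.
have vRe : dot vr vr - dot vi vi = Vj * cos delta.
  by have [<- _] := is_argE hde; rewrite vvE Re_sum_sqr.
have vIm : 2 * dot vr vi = Vj * sin delta.
  by have [_ <-] := is_argE hde; rewrite vvE Im_sum_sqr.
have wwE : (what *m what^T) 0 0 = \sum_l what 0 l * what 0 l.
  by rewrite mxE; apply: eq_bigr => k _; rewrite [what^T _ _]mxE.
have wRe : complex.Re ((what *m what^T) 0 0) = dot wr wr - dot wi wi.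
  by rewrite wwE Re_sum_sqr.
have wIm : complex.Im ((what *m what^T) 0 0) = 2 * dot wr wi.
  by rewrite wwE Im_sum_sqr.
pose g l := cos theta * wr l + sin theta * wi l.
pose h l := - sin theta * wr l + cos theta * wi l.
have [gh hg] : dot g h = 0 /\ dot h h <= dot g g.
  have := top_left_singular_rotation hsing a0 a1.
  have E (x y : R) : (fun l => x * ellipse_mx what 0 l + y * ellipse_mx what 1 l) =
     (fun l => x * wr l + y * wi l).
    by apply/funext => l; rewrite [ellipse_mx _ 0 _]mxE [ellipse_mx _ 1 _]mxE.
  by rewrite /= !E.
have c1 := cos2Dsin2 theta.
have wrE : wr = (fun l => cos theta * g l + - sin theta * h l).
  by apply/funext => l; rewrite -[LHS]mul1r -c1 /g /h; ring.
have wiE : wi = (fun l => sin theta * g l + cos theta * h l).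
  by apply/funext => l; rewrite -[LHS]mul1r -c1 /g /h; ring.
clearbody g h.
have ghn : dot g g + dot h h = 1.
  rewrite -wn wrE wiE !dot_comb (dotC h g) gh.
  by rewrite -[LHS]mul1r -c1; ring.
(* As [g] and [h] are orthogonal, the squares of the entries of [what] sum to e^(2 i theta) (|g|^2 -
   |h|^2); [hg] settles the sign of the modulus. *)
have WE : Wj = dot g g - dot h h.
  have W0 : 0 <= Wj by exact: cmod_ge0.
  have gh0 : 0 <= dot g g - dot h h by rewrite subr_ge0.
  apply/eqP; rewrite -(eqrXn2 (n := 2)) //; apply/eqP.
  rewrite sqr_cmod wRe wIm wrE wiE !dot_comb (dotC h g) gh.
  transitivity ((cos theta ^+ 2 + sin theta ^+ 2) ^+ 2 *
      (dot g g - dot h h) ^+ 2); first by ring.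
  by rewrite c1 expr1n mul1r.
have h0 : dot h h != 0.
  apply/negP => /eqP /dot_eq0 h0.
  (* If h = 0 then what = e^(i theta) g with [g] real, so conjugation only multiplies [what] by a
     phase. *)
  have whatJ : map_mx conjc what = cis (- (theta + theta)) *: what.
    apply/matrixP => i l; rewrite (ord1 i) [LHS]mxE [RHS]mxE.
    have : wr l = cos theta * g l by rewrite wrE h0; ring.
    have : wi l = sin theta * g l by rewrite wiE h0; ring.
    rewrite /wr /wi; case: (what 0 l) => x y /= -> ->.
    apply/eqP; rewrite eq_complex /= cosN sinN cosD sinD; apply/andP; split.
      by apply/eqP; rewrite -[LHS]mul1r -c1; ring.
    by apply/eqP; rewrite -[LHS]mul1r -c1; ring.
  have cZ (x : R) (X : 'rV_n) : map_mx conjc (x%:C *: X) = x%:C *: map_mx conjc X.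
    by apply/matrixP => i l; rewrite !mxE rmorphM /= oppr0.
  have dbE : dual_vec b = (cnorm2 (dual_vec b))%:C *: what.
    by rewrite /what /cunit scalerA mulfV ?scale1r // fmorph_eq0 cnorm2_neq0.
  have dualJ : dual_vec c = cis (- (theta + theta)) *: dual_vec b.
    rewrite dual_conj [in LHS]dbE cZ whatJ scalerA mulrC.
    by rewrite -scalerA -dbE.
  have /row_invmx_inj : row (jb_pos B c ord_max) (invmx (jb_mx B)) =
     cis (- (theta + theta)) *: row (jb_pos B b ord_max) (invmx (jb_mx B)) by [].
  move=> /(_ (jb_unit B)) pcb.
  (* The last vectors of both chains occupy the same column, so the chains coincide and [lambda]
     equals its conjugate, against [hIm]. *)
  have /(congr1 (@tag _ _)) /= cb : Tagged (fun b : 'I_(jb_num B) => 'I_(jb_top b).+1)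
      (@ord_max (jb_top c)) = Tagged _ (@ord_max (jb_top b)).
    exact: (bij_inj (jb_pos_bij B)).
  have [evb _] := hb; have [evc _] := hc.
  move: hIm evc; rewrite cb evb; case: (lambda) => x y /= y0 [].
  by move=> ?; lra.
(* The shift by [theta] compensates the rotation of [what]: below, p + iq = e^(i tau) vhat. *)
pose tau := omega * t + theta.
have OmegaE : Omega = (tau + tau) + delta by rewrite /Omega /tau; ring.
apply: (spectral_norm_rank2 (V := Vj) (W := Wj) (x := Omega) (g := g) (h := h)
  (p := fun k => cos tau * vr k + - sin tau * vi k)
  (q := fun k => sin tau * vr k + cos tau * vi k)).
(* By [WE] and [ghn], Wj = 1 - 2 |h|^2, which is below 1 because [h] is nonzero. *)
- rewrite WE subr_ge0 hg /=; have := dot_ge0 h; rewrite le_eqVlt eq_sym (negPf h0) /=.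
  by move=> ?; lra.
(* The entry is the real part of e^(i omega t) vhat_k what_l = (p_k + i q_k)(g_l + i h_l). *)
- move=> k l; rewrite mxE.
  have [vrk vik] := is_argE (hal k); have [wrl wil] := is_argE (hbe l).
  transitivity (cos (omega * t) * (vr k * wr l - vi k * wi l) -
      sin (omega * t) * (vr k * wi l + vi k * wr l)).
    by rewrite /vr /vi /wr /wi vrk vik wrl wil !cosD !sinD; ring.
  by rewrite wrE wiE /tau cosD sinD; ring.
- rewrite !dot_comb (dotC vi vr) -vn -[RHS]mul1r.
  by rewrite -(cos2Dsin2 tau); ring.
(* This goal and the next are the real and imaginary parts of e^(2 i tau) vv = Vj e^(i Omega). *)
- transitivity ((cos tau ^+ 2 - sin tau ^+ 2) * (Vj * cos delta) -
      2 * cos tau * sin tau * (Vj * sin delta)).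
    by rewrite -vRe -vIm !dot_comb (dotC vi vr); ring.
  by rewrite OmegaE (cosD _ delta) (cosD tau tau) (sinD tau tau); ring.
- transitivity ((cos tau ^+ 2 - sin tau ^+ 2) * (Vj * sin delta) +
      2 * cos tau * sin tau * (Vj * cos delta)).
    by rewrite -vRe -vIm !dot_comb (dotC vi vr); ring.
  by rewrite OmegaE (sinD _ delta) (cosD tau tau) (sinD tau tau); ring.
- by rewrite WE; lra.
- by rewrite WE; lra.
- exact: gh.
Qed.
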